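(* If $\{X(t)\}_{t\geq 0}$ is an ss-si process, then $\{X_n\}_{n\in\mathbb{N}_0}$ given by $X_n=X(n)$, $n\in\mathbb{N}_0$, is a dt-ss-si process. Conversely, if $\{X_n\}_{n\in\mathbb{N}_0}$ is a dt-ss-si process with scaling function $b(n)=n^H$ for some $H>0$, then there exists a unique in distribution ss-si process $\{X(t)\}_{t\geq 0}$ such that $\{X(n)\}_{n\in\mathbb{N}_0}\overset{d}{=}\{X_n\}_{n\in\mathbb{N}_0}$.
   Context: $\mathbb{N}=\{1,2,\dots\}$, $\mathbb{N}_0=\{0,1,2,\dots\}$; $\overset{d}{=}$ denotes equality in distribution (for processes: equality of all finite-dimensional distributions), and ''unique in distribution'' means unique up to equality of finite-dimensional distributions. All processes are real-valued. A continuous-time process $\{X(t)\}_{t\ge 0}$ is ss-si (self-similar with stationary increments) if there is $H\geq 0$ such that $\{X(at)\}_{t\ge0}\overset{d}{=}\{a^HX(t)\}_{t\ge0}$ for every $a>0$, and $\{X(t+h)-X(h)\}_{t\geq 0}\overset{d}{=}\{X(t)-X(0)\}_{t\geq 0}$ for every $h\ge 0$. A process $\{X_m\}_{m\in\mathbb{N}_0}$ is dt-ss-si with scaling function $b:\mathbb N\to(0,\infty)$ if $\{X_{nm}\}_{m\in\mathbb{N}_0}\overset{d}{=}\{b(n)X_m\}_{m\in\mathbb{N}_0}$ for every $n\in\mathbb{N}$, and $\{X_{m+1}-X_m\}_{m\in\mathbb{N}_0}\overset{d}{=}\{X_{m+k+1}-X_{m+k}\}_{m\in\mathbb{N}_0}$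 for every $k\in\mathbb{N}$. *)

(* Defs.v *)
From HB Require Import structures.
From mathcomp Require Import all_boot all_order all_algebra.
From mathcomp Require Import all_classical all_reals all_analysis.
Import Order.TTheory GRing.Theory Num.Theory.
Import numFieldNormedType.Exports.

Set Implicit Arguments.
Unset Strict Implicit.
Unset Printing Implicit Defensive.

Local Open Scope classical_set_scope.
Local Open Scope ring_scope.

Definition joint (I T R : Type) (X : I -> T -> R) n (t : n.-tuple I) (w : T) :
  n.-tuple R := [tuple X (tnth t i) w | i < n].

Lemma measurable_joint d (T : measurableType d) (R : realType) (I : Type)
    (X : I -> {mfun T >-> R}) n (t : n.-tuple I) :
  measurable_fun [set: T] (joint X t).
Proof.
apply/measurable_fun_tnthP => i.
have -> : (@tnth n R)^~ i \o joint X t = X (tnth t i).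
  by apply/funext => w /=; rewrite tnth_mktuple.
exact: measurable_funPT.
Qed.

(* The two processes may live on different probability spaces.  They are taken
   as families of plain functions, so that pointwise expressions in random
   variables can be written directly; [eq_fdd] is only meant for families of
   measurable functions, for which [pushforward P (joint X t)] is the law of
   the random vector [joint X t] (see [measurable_joint]). *)
Definition eq_fdd (I : Type) (R : realType)
    (d : measure_display) (T : measurableType d) (P : probability T R)
    (d' : measure_display) (T' : measurableType d') (P' : probability T' R)
    (X : I -> T -> R) (Y : I -> T' -> R) : Prop :=
  forall n (t : n.-tuple I) (B : set (n.-tuple R)), measurable B ->
    pushforward P (joint X t) B = pushforward P' (joint Y t) B.

Section self_similar.
Context {d : measure_display} {T : measurableType d} {R : realType}
  {P : probability T R}.

Definition ss_si (X : {nonneg R} -> {RV P >-> R}) : Prop :=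
  (exists2 H : R, 0 <= H & forall a : {posnum R},
     eq_fdd P P (fun (t : {nonneg R}) w => X (a%:num * t%:num)%:nng w)
                (fun t w => a%:num `^ H * X t w)) /\
  (forall h : {nonneg R},
     eq_fdd P P (fun (t : {nonneg R}) w => X (t%:num + h%:num)%:nng w - X h w)
                (fun t w => X t w - X 0%:nng w)).

(* The scaling function is defined on positive integers: the value b 0 is
   never used. *)
Definition dt_ss_si_with (b : nat -> R) (X : nat -> {RV P >-> R}) : Prop :=
  [/\ forall n, (0 < n)%N -> 0 < b n,
      forall n, (0 < n)%N ->
        eq_fdd P P (fun m w => X (n * m)%N w) (fun m w => b n * X m w)
    & forall k, (0 < k)%N ->
        eq_fdd P P (fun m w => X (m + 1)%N w - X m w)
                   (fun m w => X (m + k + 1)%N w - X (m + k)%N w)].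

Definition dt_ss_si (X : nat -> {RV P >-> R}) : Prop :=
  exists b : nat -> R, dt_ss_si_with b X.

Definition skeleton (X : {nonneg R} -> {RV P >-> R}) (n : nat) :
  {RV P >-> R} := X (n%:R)%:nng.

End self_similar.

(* Main.v *)
Require Import Defs.
From HB Require Import structures.
From mathcomp Require Import all_boot all_order all_algebra.
From mathcomp Require Import all_classical all_reals all_analysis.
From mathcomp Require Import measurable_realfun.
From mathcomp Require Import lra ring.
Import Order.TTheory GRing.Theory Num.Theory.
Import numFieldNormedType.Exports.

Set Implicit Arguments.
Unset Strict Implicit.
Unset Printing Implicit Defensive.

Local Open Scope classical_set_scope.
Local Open Scope ring_scope.

(** The forward direction is a direct computation: increments of the skeleton
are linear combinations of values of the process, and [eq_fdd] is stable under
finite linear combinations ([eq_fdd_by]).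

For the converse, let [X] have scaling function n^H and put
V = X 1 - X 0 ([unit_increment]).  Stationarity and scaling give [X i - X j] the law of
|i - j|^H V ([increment_tail]), so an increment over o(n) steps, divided by
n^H, tends to 0 in probability: this is where [H > 0] enters.

Existence.  The candidate is the limit of the rescaled walks
N^(-H) X_(floor (N t)), where N = (k + 1)^2.  They converge only in law, so
the limit needs a new probability space.  The Loeb measure supplies one that
serves all real times at once: points are sequences in [T], an internal set is
an ultraproduct of events, its measure is the ultralimit of their
probabilities, and countable additivity comes for free from saturation
([star_saturation], [loeb_near]).  On that space the ultralimit of the rescaled
walks exists almost surely ([ae_cvg_process]) and defines [process].  An
identity in law between two families that holds at each finite stage passes to
their almost sure ultralimits ([loeb_cvg_law], [cvg_law_unique]), and changing
the index by O(k) does not affect the limit ([ae_cvg_scaled_index]).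
Stationarity of increments compares floor (N (t + h)) with
floor (N t) + floor (N h).  Self-similarity for an arbitrary real a compares
floor (N a t) with the product of floor ((k + 1) a) and floor ((k + 1) t): the
index error O(k) is negligible because N = (k + 1)^2, and the first factor is
an integer, to which the discrete scaling applies.

Uniqueness.  If [Z] is self-similar with exponent H' and its skeleton has the
law of [X], then n^H' X and n^H X have the same law, for every n >= 1.
Hence Z at the points m / n has the law of n^(-H) X ([frac_law]), and
Z (t) - Z (floor (N t) / N) tends to 0 in probability
([small_increment_tail]); so Z is the limit in law of the same rescaled
walks. *)

(** * Laws of finite families of random variables *)

Section orthants.
Context {R : realType}.

Definition below (I T : Type) (X : I -> T -> R) n (t : n.-tuple I)
  (a : 'I_n -> R) : set T := [set w | forall i, X (tnth t i) w < a i].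

Lemma preimage_joint_orthant (I T : Type) (X : I -> T -> R) n (t : n.-tuple I)
    (a : 'I_n -> R) :
  joint X t @^-1` [set x | forall i, tnth x i < a i] = below X t a.
Proof.
by apply/seteqP; split => w /= h i; have := h i; rewrite tnth_mktuple.
Qed.

Lemma measurable_lt d (T : measurableType d) (f : T -> R) (a : R) :
  measurable_fun setT f -> measurable [set w | f w < a].
Proof.
move=> mf; have := mf measurableT _ (measurable_itv `]-oo, a[).
by rewrite setTI.
Qed.

Lemma measurable_below d (T : measurableType d) (I : Type) (X : I -> T -> R)
    n (t : n.-tuple I) (a : 'I_n -> R) :
  (forall i, measurable_fun setT (X i)) -> measurable (below X t a).
Proof.
move=> mX.
have -> : below X t a = \bigcap_i [set w | X (tnth t i) w < a i].
  by apply/seteqP; split => w /= h i; [move=> _|]; exact: h.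
apply: fin_bigcap_measurable; first exact: finite_finset.
by move=> i _; exact: measurable_lt.
Qed.

Lemma measurable_joint_fun d (T : measurableType d) (I : Type)
    (X : I -> T -> R) n (t : n.-tuple I) :
  (forall i, measurable_fun setT (X i)) -> measurable_fun setT (joint X t).
Proof.
move=> mX; apply/measurable_fun_tnthP => i.
have -> : (@tnth n R)^~ i \o joint X t = X (tnth t i).
  by apply/funext => w /=; rewrite tnth_mktuple.
exact: mX.
Qed.

Lemma exists_nat_gt (x : R) : exists k : nat, x < k%:R.
Proof.
by exists (Num.truncn `|x|).+1; rewrite (le_lt_trans (ler_norm _))// truncnS_gt.
Qed.

(** Strict lower orthants form a generating pi-system of the product
sigma-algebra that also exhausts the space: the half-line preimage under one
coordinate is a union of orthants whose other bounds go to infinity. *)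
Lemma measurable_tuple_orthants n :
  @measurable _ (n.-tuple R) =
  <<s [set B | exists a : 'I_n -> R, B = [set x | forall i, tnth x i < a i]] >>.
Proof.
apply/seteqP; split; last first.
  apply: smallest_sub; first exact: sigma_algebra_measurable.
  move=> _ [a ->].
  have -> : [set x : n.-tuple R | forall i, tnth x i < a i] =
      \bigcap_i [set x : n.-tuple R | tnth x i < a i].
    by apply/seteqP; split => w /= h i; [move=> _|]; exact: h.
  apply: fin_bigcap_measurable; first exact: finite_finset.
  by move=> i _; apply: measurable_lt; exact: measurable_tnth.
set S := <<s _ >>.
apply: smallest_sub; first exact: smallest_sigma_algebra.
rewrite -bigcup_seq => B [/= i _ [C mC <-]].
rewrite setTI.
have {mC} : (@ocitv R).-sigma.-measurable C by [].
rewrite RGenInftyO.measurableE.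
pose Q := [set C | S ((fun x : n.-tuple R => tnth x i) @^-1` C)].
apply: (_ : <<s @RGenInftyO.G R >> `<=` Q) C.
have sS : sigma_algebra setT S by exact: smallest_sigma_algebra.
apply: smallest_sub.
  case: sS => S0 SD SU; split.
  - by rewrite /Q /= preimage_set0.
  - by move=> C QC; rewrite /Q /= setTD preimage_setC -setTD; exact: SD.
  - by move=> F QF; rewrite /Q /= preimage_bigcup; exact: SU.
move=> _ [a ->]; rewrite /Q /=.
have -> : (fun x : n.-tuple R => tnth x i) @^-1` `]-oo, a[%classic =
    \bigcup_k [set x : n.-tuple R | forall j, tnth x j < if j == i then a else k%:R].
  apply/seteqP; split => x /=; rewrite in_itv /=; last first.
    by case=> k _ /(_ i); rewrite eqxx.
  move=> xia; have [k hk] := exists_nat_gt (\sum_j `|tnth x j|).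
  exists k => // j; case: eqP => [-> //|_].
  apply: le_lt_trans hk; apply: (le_trans (ler_norm _)).
  by rewrite (bigD1 j) //= lerDl sumr_ge0.
case: sS => _ _; apply => k; apply: sub_sigma_algebra.
by exists (fun j => if j == i then a else k%:R).
Qed.

Context d d' (T : measurableType d) (T' : measurableType d').
Variables (P : probability T R) (P' : probability T' R).

(** A law on tuples is determined by its joint distribution function, so
equality of finite-dimensional distributions can be tested on orthants. *)
Lemma eq_fdd_below (I : Type) (X : I -> T -> R) (Y : I -> T' -> R) :
  (forall i, measurable_fun setT (X i)) ->
  (forall i, measurable_fun setT (Y i)) ->
  (forall n (t : n.-tuple I) a, P (below X t a) = P' (below Y t a)) ->
  eq_fdd P P' X Y.
Proof.
move=> mX mY XY n t B mB.
pose JX : {mfun T >-> n.-tuple R} := mfun_Sub (mem_set (measurable_joint_fun t mX)).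
pose JY : {mfun T' >-> n.-tuple R} := mfun_Sub (mem_set (measurable_joint_fun t mY)).
suff : distribution P JX B = distribution P' JY B by [].
have setI : setI_closed [set B : set (n.-tuple R) | exists a : 'I_n -> R,
    B = [set x | forall i, tnth x i < a i]].
  move=> _ _ [a ->] [b ->]; exists (fun i => Num.min (a i) (b i)).
  apply/seteqP; split => x /=.
    by move=> [ha hb] i; rewrite lt_min ha hb.
  by move=> h; split => i; have := h i; rewrite lt_min => /andP[].
apply: (measure_unique _ (fun k : nat => [set x : n.-tuple R | forall i, tnth x i < k%:R])
  (measurable_tuple_orthants n) setI).
- by move=> k; exists (fun=> k%:R).
- apply/seteqP; split => x //= _; have [k hk] := exists_nat_gt (\sum_j `|tnth x j|).
  exists k => // j.
  apply: le_lt_trans hk; apply: (le_trans (ler_norm _)).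
  by rewrite (bigD1 j) //= lerDl sumr_ge0.
- move=> _ [a ->]; have := XY n t a; rewrite -!preimage_joint_orthant.
  by rewrite /distribution /pushforward.
- move=> k; apply: (@le_lt_trans _ _ 1%E); last exact: ltry.
  apply: probability_le1.
  by rewrite measurable_tuple_orthants; apply: sub_sigma_algebra; exists (fun=> k%:R).
- by []. Qed.

Lemma eq_fdd_belowE (I : Type) (X : I -> T -> R) (Y : I -> T' -> R) :
  eq_fdd P P' X Y ->
  forall n (t : n.-tuple I) a, P (below X t a) = P' (below Y t a).
Proof.
move=> XY n t a.
rewrite -!preimage_joint_orthant; apply: XY.
by rewrite measurable_tuple_orthants; apply: sub_sigma_algebra; exists a.
Qed.

Lemma eq_fdd1 (I : Type) (X : I -> T -> R) (Y : I -> T' -> R) i (B : set R) :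
  eq_fdd P P' X Y -> measurable B -> P (X i @^-1` B) = P' (Y i @^-1` B).
Proof.
move=> XY mB.
have := XY 1%N [tuple i] ((fun x => tnth x ord0) @^-1` B).
rewrite /pushforward.
have JE (U : Type) (Z : I -> U -> R) :
    joint Z [tuple i] @^-1` ((fun x => tnth x ord0) @^-1` B) = Z i @^-1` B.
  by apply/seteqP; split => w /=; rewrite tnth_mktuple (tnth_nth i).
rewrite !JE; apply.
by rewrite -[X in measurable X]setTI; apply: measurable_tnth.
Qed.

End orthants.

Section lincomb.
Context {R : realType}.

Definition lincomb (I T : Type) (X : I -> T -> R) (s : seq (R * I)) (w : T) : R :=
  \sum_(p <- s) p.1 * X p.2 w.

(** The finitely many coefficients and indices needed for a tuple [t] are read off
a single tuple of values of [X] by a measurable map, so the law of that tuple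
determines the joint law of the combinations. *)
Lemma eq_fdd_lincomb d d' (T : measurableType d) (T' : measurableType d')
    (P : probability T R) (P' : probability T' R)
    (I : eqType) (J : Type) (L : J -> seq (R * I)) (X : I -> T -> R) (Y : I -> T' -> R) :
  eq_fdd P P' X Y ->
  eq_fdd P P' (fun j => lincomb X (L j)) (fun j => lincomb Y (L j)).
Proof.
move=> XY n t B mB.
(* All indices that occur, possibly with repetitions; [index] finds each one. *)
pose s := flatten [seq map snd (L j) | j <- t].
pose phi (x : (size s).-tuple R) : n.-tuple R :=
  [tuple \sum_(p <- L (tnth t i)) p.1 * nth 0 x (index p.2 s) | i < n].
have mphi : measurable_fun setT phi.
  apply/measurable_fun_tnthP => i.
  have -> : (@tnth n R)^~ i \o phi =
      fun x => \sum_(p <- L (tnth t i)) p.1 * nth 0 x (index p.2 s).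
    by apply/funext => x /=; rewrite tnth_mktuple.
  apply: measurable_sum => p; apply: measurable_funM => //.
  have [lt|ge] := ltnP (index p.2 s) (size s).
    have -> : (fun x : (size s).-tuple R => nth 0 x (index p.2 s)) =
        fun x => tnth x (Ordinal lt) by apply/funext => x; rewrite (tnth_nth 0).
    exact: measurable_tnth.
  have -> : (fun x : (size s).-tuple R => nth 0 x (index p.2 s)) = cst 0.
    by apply/funext => x; rewrite nth_default // size_tuple.
  exact: measurable_cst.
have JE (U : Type) (Z : I -> U -> R) :
    joint (fun j => lincomb Z (L j)) t = phi \o joint Z (in_tuple s).
  apply/funext => w; apply: eq_from_tnth => i; rewrite !tnth_mktuple.
  apply: eq_big_seq => p pL; congr (_ * _).
  have ps : p.2 \in s.
    apply/flattenP; exists (map snd (L (tnth t i))); last exact: map_f.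
    apply/(nthP [::]); exists i; rewrite ?size_map ?size_tuple//.
    by rewrite (nth_map (tnth t i)) ?size_tuple// -tnth_nth.
  have lt : (index p.2 s < size s)%N by rewrite index_mem.
  rewrite -(tnth_nth 0 _ (Ordinal lt)) tnth_mktuple.
  by rewrite (tnth_nth p.2) /= nth_index.
rewrite /pushforward !JE.
by apply: (XY _ (in_tuple s) (phi @^-1` B)); rewrite -[X in measurable X]setTI; exact: mphi.
Qed.

Lemma eq_fdd_trans d1 d2 d3 (T1 : measurableType d1) (T2 : measurableType d2)
    (T3 : measurableType d3) (P1 : probability T1 R) (P2 : probability T2 R)
    (P3 : probability T3 R) (I : Type) (X : I -> T1 -> R) (Y : I -> T2 -> R)
    (Z : I -> T3 -> R) :
  eq_fdd P1 P2 X Y -> eq_fdd P2 P3 Y Z -> eq_fdd P1 P3 X Z.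
Proof. by move=> XY YZ n t B mB; rewrite XY// YZ. Qed.

Lemma eq_fdd_sym d1 d2 (T1 : measurableType d1) (T2 : measurableType d2)
    (P1 : probability T1 R) (P2 : probability T2 R)
    (I : Type) (X : I -> T1 -> R) (Y : I -> T2 -> R) :
  eq_fdd P1 P2 X Y -> eq_fdd P2 P1 Y X.
Proof. by move=> XY n t B mB; rewrite XY. Qed.

End lincomb.

(** * Convergence of finite-dimensional laws along a filter *)

Section convergence_in_law.
Context {R : realType}.
Implicit Type e : R.

(** Closeness in the Levy metric, eventually along [U], of all joint distribution
functions; a shift by [e] in both directions avoids any discussion of
continuity points.  The approximations and the limit may live on different
spaces. *)
Definition cvg_law (U : set_system nat) d d' (T : measurableType d)
    (T' : measurableType d') (P : probability T R) (P' : probability T' R)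
    (I : Type) (A : nat -> I -> T -> R) (Y : I -> T' -> R) : Prop :=
  forall n (t : n.-tuple I) (a : 'I_n -> R) e, 0 < e -> \forall k \near U,
   (P (below (A k) t a) <= P' (below Y t (fun i => a i + e)%R) + e%:E)%E /\
   (P' (below Y t a) <= P (below (A k) t (fun i => a i + e)%R) + e%:E)%E.

Lemma sub_below (I T : Type) (X : I -> T -> R) n (t : n.-tuple I) (a b : 'I_n -> R) :
  (forall i, a i <= b i) -> below X t a `<=` below X t b.
Proof. by move=> ab w h i; exact: lt_le_trans (h i) (ab i). Qed.

Lemma le_prob d (T : measurableType d) (P : probability T R) (A B : set T) :
  measurable A -> measurable B -> A `<=` B -> (P A <= P B)%E.
Proof. by move=> mA mB AB; apply: le_measure; rewrite ?inE. Qed.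

(** Joint distribution functions of strict orthants are continuous from below. *)
Lemma below_left_limit d (T : measurableType d) (P : probability T R) (I : Type)
    (X : I -> T -> R) n (t : n.-tuple I) (a : 'I_n -> R) (x : \bar R) :
  (forall i, measurable_fun setT (X i)) ->
  (forall e, 0 < e -> (P (below X t (fun i => a i - e)%R) <= x)%E) ->
  (P (below X t a) <= x)%E.
Proof.
move=> mX ub; pose F k := below X t (fun i => a i - k.+1%:R^-1).
have mF k : measurable (F k) by exact: measurable_below.
have aF : below X t a = \bigcup_k F k.
  apply/seteqP; split => w; last first.
    by move=> [k _ h] i; rewrite (lt_le_trans (h i))// gerBl.
  move=> h.
  have [k hk] := exists_nat_gt (\sum_i (a i - X (tnth t i) w)^-1).
  exists k => // i; rewrite ltrBrDl -ltrBrDr.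
  have ai : 0 < a i - X (tnth t i) w by rewrite subr_gt0.
  rewrite -[ltRHS]invrK ltf_pV2 ?posrE ?invr_gt0//.
  apply: (@lt_trans _ _ k%:R); last by rewrite ltr_nat.
  apply: le_lt_trans hk; rewrite (bigD1 i)//= lerDl sumr_ge0// => j _.
  by rewrite invr_ge0 subr_ge0 ltW.
have nF : nondecreasing_seq F.
  move=> p q pq; apply/subsetPset; apply: sub_below => i.
  by rewrite lerB// lef_pV2 ?posrE// ler_nat.
have cF := nondecreasing_cvg_mu mF (bigcup_measurable (fun k _ => mF k)) nF.
rewrite aF -(cvg_lim _ (cF _ P))//.
apply: lime_le.
  by apply/cvg_ex; eexists; exact: cF.
by apply: nearW => k /=; exact: ub.
Qed.

(** Limits in law are unique: chaining the Levy bounds through a common stage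
compares the two joint distribution functions up to an arbitrarily small shift,
which continuity from below removes. *)
Lemma cvg_law_unique (U : set_system nat) {FU : ProperFilter U}
    d1 d2 d3 d4 (T1 : measurableType d1)
    (T2 : measurableType d2) (T3 : measurableType d3) (T4 : measurableType d4)
    (P : probability T1 R) (Q : probability T2 R) (P' : probability T3 R)
    (Q' : probability T4 R) (I : Type) (A : nat -> I -> T1 -> R)
    (B : nat -> I -> T2 -> R) (Y : I -> T3 -> R) (Z : I -> T4 -> R) :
  (forall i, measurable_fun setT (Y i)) -> (forall i, measurable_fun setT (Z i)) ->
  cvg_law U P P' A Y -> cvg_law U Q Q' B Z ->
  (\forall k \near U, eq_fdd P Q (A k) (B k)) -> eq_fdd P' Q' Y Z.
Proof.
move=> mY mZ AY BZ AB.
have half d5 d6 d7 d8 (S1 : measurableType d5) (S2 : measurableType d6)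
    (S3 : measurableType d7) (S4 : measurableType d8) (P1 : probability S1 R)
    (P2 : probability S2 R) (P3 : probability S3 R) (P4 : probability S4 R)
    (C : nat -> I -> S1 -> R) (D : nat -> I -> S2 -> R) (V : I -> S3 -> R)
    (W : I -> S4 -> R) :
    (forall i, measurable_fun setT (V i)) -> (forall i, measurable_fun setT (W i)) ->
    cvg_law U P1 P3 C V -> cvg_law U P2 P4 D W ->
    (\forall k \near U, eq_fdd P1 P2 (C k) (D k)) ->
    forall n (t : n.-tuple I) a, (P3 (below V t a) <= P4 (below W t a))%E.
  move=> mV mW CV DW CD n t a; apply/lee_addgt0Pr => x x0.
  apply: below_left_limit => // e e0.
  (* Two Levy bounds are chained, so each may use half of the budget. *)
  pose e' := Num.min e x / 2.
  have e'0 : 0 < e' by rewrite divr_gt0// lt_min e0.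
  have e'e : e' * 2 <= e by rewrite divfK// ge_min lexx.
  have e'x : e' * 2 <= x by rewrite divfK// ge_min lexx orbT.
  have [k [[[_ h1] [h2 _]] h3]] := @filter_ex _ U _ _ (@filterI _ U _ _ _
    (@filterI _ U _ _ _ (CV n t (fun i => a i - e' * 2)%R e' e'0)
      (DW n t (fun i => a i - e')%R e' e'0)) CD).
  have ee : (fun i => a i - e' * 2 + e')%R = (fun i => a i - e')%R.
    by apply/funext => i; lra.
  rewrite ee (eq_fdd_belowE h3) in h1.
  apply: (@le_trans _ _ (P3 (below V t (fun i => a i - e' * 2)%R))).
    apply: le_prob; try exact: measurable_below.
    by apply: sub_below => i; lra.
  apply: (le_trans h1); apply: (le_trans (leeD2r _ h2)).
  rewrite -addeA -EFinD; apply: leeD; last by rewrite lee_fin; lra.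
  apply: le_prob; try exact: measurable_below.
  by apply: sub_below => i; lra.
apply: eq_fdd_below => // n t a; apply/eqP; rewrite eq_le; apply/andP; split.
  exact: (half _ _ _ _ _ _ _ _ P Q P' Q' A B Y Z mY mZ AY BZ AB).
apply: (half _ _ _ _ _ _ _ _ Q P Q' P' B A Z Y mZ mY BZ AY).
by apply: filterS AB => k; exact: eq_fdd_sym.
Qed.

(** Convergence to 0 in probability; one parameter bounds both the deviation and
its probability, as in the Ky Fan metric. *)
Definition infinitesimal d (T : measurableType d) (P : probability T R)
    (f : nat -> T -> R) : Prop :=
  forall e, 0 < e -> \forall k \near \oo, (P [set w | e < `|f k w|]%R <= e%:E)%E.

Lemma measurable_gt_norm d (T : measurableType d) (f : T -> R) e :
  measurable_fun setT f -> measurable [set w | e < `|f w|].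
Proof.
move=> mf; have := measurableT_comp (@normr_measurable R setT) mf.
move=> /(_ measurableT _ (measurable_itv `]e, +oo[)); rewrite setTI.
congr measurable; apply/seteqP; split => w /=; by rewrite in_itv /= andbT.
Qed.

Lemma cvg_law_in_prob (U : set_system nat) {FU : Filter U} d (T : measurableType d)
    (P : probability T R) (I : Type) (A : nat -> I -> T -> R) (Y : I -> T -> R) :
  U `=>` \oo -> 
  (forall k i, measurable_fun setT (A k i)) -> (forall i, measurable_fun setT (Y i)) ->
  (forall i, infinitesimal P (fun k w => A k i w - Y i w)) ->
  cvg_law U P P A Y.
Proof.
move=> Uoo mA mY AY n t a e e0.
(* A union bound over the [n] coordinates; [n.+1] also covers [n = 0]. *)
pose e' := e / n.+1%:R.
have e'0 : 0 < e' by rewrite divr_gt0.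
have e'e : e' <= e by rewrite ler_pdivrMr// ler_peMr ?ler1n// ltW.
have n1 (i : 'I_n) : \forall k \near U,
    (P [set w | e' < `|A k (tnth t i) w - Y (tnth t i) w|]%R <= e'%:E)%E.
  exact: Uoo (AY (tnth t i) e' e'0).
have {}n1 := @filter_forall _ _ _ U FU n1.
apply: filterS n1 => k hk.
pose E := \big[setU/set0]_(i < n) [set w | e' < `|A k (tnth t i) w - Y (tnth t i) w|].
have [mE PE] : measurable E /\ (P E <= e%:E)%E.
  suff [mE PE] : measurable E /\ (P E <= (\sum_(i < n) e')%:E)%E.
    split => //; apply: (le_trans PE); rewrite lee_fin sumr_const card_ord -mulr_natl.
    by rewrite /e' mulrCA ler_piMr ?(ltW e0)// ler_pdivrMr// mul1r ler_nat.
  rewrite /E; apply: (big_rec2 (fun (G : set T) (s : R) =>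
    measurable G /\ (P G <= s%:E)%E)) => [|i G s _ [mG PG]].
    by rewrite measure0.
  have mi : measurable [set w | e' < `|A k (tnth t i) w - Y (tnth t i) w|].
    by apply: measurable_gt_norm; exact: measurable_funB.
  split; first exact: measurableU.
  rewrite EFinD; apply: (le_trans (measureU2 P mi mG)).
  by apply: leeD => //; exact: hk.
have notE w : ~ E w -> forall i, `|A k (tnth t i) w - Y (tnth t i) w| <= e.
  rewrite /E -bigcup_seq => Ew i; rewrite leNgt; apply/negP => lt; apply: Ew.
  by exists i => /=; [rewrite mem_index_enum|exact: le_lt_trans lt].
have bound (B C : set T) : measurable B -> measurable C -> B `\` E `<=` C ->
    (P B <= P C + e%:E)%E.
  move=> mB mC BC; apply: (@le_trans _ _ (P (C `|` E))).
    apply: le_prob => //; first exact: measurableU.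
    by move=> w Bw; have [Ew|Ew] := pselect (E w); [right|left; exact: BC].
  by apply: (le_trans (measureU2 P mC mE)); exact: leeD2l.
split; apply: bound; try exact: measurable_below.
  move=> w [h Ew] i; have := h i; have := notE w Ew i.
  by rewrite ler_norml => /andP[]; lra.
move=> w [h Ew] i; have := h i; have := notE w Ew i.
by rewrite ler_norml => /andP[]; lra.
Qed.

End convergence_in_law.

(** * Loeb probability spaces *)

(** Any ultrafilter finer than [\oo], hence non-principal. *)
Definition free_ultrafilter : set_system nat :=
  sval (cid (ultraFilterLemma (eventually_filter : ProperFilter (\oo : set_system nat)))).


Instance free_ultrafilter_ultra : UltraFilter free_ultrafilter.
Proof. by rewrite /free_ultrafilter; case: cid => U []. Qed.

Local Notation omega := free_ultrafilter.

Lemma free_ultrafilter_eventually : omega `=>` \oo.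
Proof. by rewrite /free_ultrafilter; case: cid => U []. Qed.

Lemma omega_imp (P Q : nat -> Prop) : (forall n, P n -> Q n) ->
  (\forall n \near omega, P n) -> \forall n \near omega, Q n.
Proof. exact: (@filterS _ omega). Qed.

Lemma omega_and (P Q : nat -> Prop) : (\forall n \near omega, P n) ->
  (\forall n \near omega, Q n) -> \forall n \near omega, P n /\ Q n.
Proof. exact: (@filterI _ omega). Qed.

Lemma omega_ex (P : nat -> Prop) : (\forall n \near omega, P n) -> exists n, P n.
Proof. exact: (@filter_ex _ omega). Qed.

Lemma omega_not (P : nat -> Prop) :
  ~ (\forall n \near omega, P n) -> \forall n \near omega, ~ P n.
Proof. by have [|] := in_ultra_setVsetC [set n | P n] free_ultrafilter_ultra. Qed.

(** Compactness of a segment: an ultrafilter converges as soon as it has a cluster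
point. *)
Lemma ultra_bounded_cvg (R : realType) (f : nat -> R) (M : R) :
  (\forall n \near omega, `|f n| <= M) -> cvg (f @ omega).
Proof.
move=> fM.
have PF : ProperFilter (f @ omega) by apply: fmap_proper_filter.
have [|p [_ cp]] := @segment_compact R (- M) M (f @ omega) PF.
  by apply: omega_imp fM => n; rewrite /= in_itv /= -ler_norml.
apply/cvg_ex; exists p => N Np.
have [//|nN] := in_ultra_setVsetC (f @^-1` N) free_ultrafilter_ultra.
by have [x [/=]] := cp (~` N) N nN Np.
Qed.

Section hyper.
Context {d : measure_display} {T : measurableType d}.

(** The internal set defined by a sequence of sets.  Sequences are not identified
modulo the ultrafilter: internal sets are saturated for that equivalence, so
the quotient would carry the same measure. *)
Definition star (A : nat -> set T) : set (nat -> T) :=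
  [set w | \forall n \near omega, A n (w n)].

(** If the inclusion failed for most [n], a sequence of witnesses of the failures
would lie in [star A] but not in [star B]. *)
Lemma star_sub A B : star A `<=` star B -> \forall n \near omega, A n `<=` B n.
Proof.
move=> AB.
apply: contrapT => /omega_not nAB.
have [w hw] : exists w : nat -> T, forall n, ~ (A n `<=` B n) -> A n (w n) /\ ~ B n (w n).
  suff /choice[w hw] n : exists x, ~ (A n `<=` B n) -> A n x /\ ~ B n x by exists w.
  have [AnBn|/existsNP[x /not_implyP[Ax nBx]]] := pselect (A n `<=` B n).
    by exists point.
  by exists x.
have Aw : star A w by apply: omega_imp nAB => n /hw[].
by have [n [Bn /hw[]]] := omega_ex (omega_and (AB _ Aw) nAB).
Qed.

Lemma star_inj A B : star A = star B -> \forall n \near omega, A n = B n.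
Proof.
move=> AB; have h1 : star A `<=` star B by rewrite AB.
have h2 : star B `<=` star A by rewrite AB.
have h := omega_and (star_sub h1) (star_sub h2).
by apply: omega_imp h => n [? ?]; apply/seteqP.
Qed.

Lemma star0 : star (fun=> set0) = set0.
Proof. by apply/seteqP; split => w //= /filter_ex[]. Qed.

Lemma starT : star (fun=> setT) = setT.
Proof. by apply/seteqP; split => w //= _; exact: filterE. Qed.

Lemma starC A : star (fun n => ~` A n) = ~` star A.
Proof.
apply/seteqP; split => w /= h.
  by move=> Aw; have [n []] := omega_ex (omega_and h Aw).
exact: omega_not.
Qed.

Lemma starI A B : star (fun n => A n `&` B n) = star A `&` star B.
Proof.
apply/seteqP; split => w /= h.
  by split; apply: omega_imp h => n [].
by case: h; exact: omega_and.
Qed.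

Lemma starU A B : star (fun n => A n `|` B n) = star A `|` star B.
Proof.
apply: setC_inj; rewrite setCU -!starC -starI; congr star.
by apply/funext => n; rewrite setCU.
Qed.

(** Countable saturation: an internal set covered by countably many internal sets
is covered by finitely many of them.  Otherwise, at most stages [n] there are
points of [B n] outside the first [N] covering sets; a diagonal choice, with
[N] as large as possible but at most [n], yields a sequence in [star B] outside
all of them. *)
Lemma star_saturation (A : nat -> nat -> set T) (B : nat -> set T) :
  star B `<=` \bigcup_k star (A k) ->
  exists N, star B `<=` \bigcup_(k < N) star (A k).
Proof.
move=> BA; apply: contrapT => /forallNP no.
pose Q N n := [set x | B n x /\ forall k, (k < N)%N -> ~ A k n x].
have Qdec N M n : (N <= M)%N -> Q M n `<=` Q N n.
  by move=> NM x [Bx Ax]; split => // k kN; apply: Ax; exact: leq_trans NM.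
have QU N : \forall n \near omega, Q N n !=set0.
  apply: contrapT => /omega_not nQ; apply: (no N) => w Bw; apply: contrapT => nAw.
  have {}nAw k : (k < N)%N -> star (fun n => ~` A k n) w.
    by move=> kN; rewrite starC => Akw; apply: nAw; exists k.
  have all : \forall n \near omega, forall k : 'I_N, ~ A k n (w n).
    apply: (@filter_forall _ 'I_N (fun k n => ~ A k n (w n)) omega _) => k.
    exact: nAw.
  have [n [[Bn An] /=]] := @filter_ex _ omega _ _
    (omega_and (omega_and Bw all) nQ).
  by apply; exists (w n); split => // k kN; exact: (An (Ordinal kN)).
(* The sets [Q N n] decrease with [N], so a point of the last nonempty one works. *)
have pick n M : exists x, forall N, (N <= M)%N -> Q N n !=set0 -> Q N n x.
  elim: M => [|M [x IH]].
    have [[x Qx]|nQ] := pselect (Q 0%N n !=set0).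
      by exists x => N; rewrite leqn0 => /eqP ->.
    by exists point => N; rewrite leqn0 => /eqP ->.
  have [[y Qy]|nQ] := pselect (Q M.+1 n !=set0).
    by exists y => N NM _; exact: Qdec Qy.
  exists x => N; rewrite leq_eqVlt => /predU1P[->//|]; rewrite ltnS; exact: IH.
have [w hw] := choice (fun n => pick n n).
have Qw N : \forall n \near omega, Q N n (w n).
  (* Non-principality: the bound [N <= n] of the choice holds for most [n]. *)
  have NU : \forall n \near omega, (N <= n)%N.
    by apply: free_ultrafilter_eventually; exact: nbhs_infty_ge.
  by apply: omega_imp (omega_and NU (QU N)) => n [Nn Qn]; exact: hw.
have Bw : star B w by apply: omega_imp (Qw 0%N) => n [].
have [k _ Akw] := BA _ Bw.
have [n [[_ nA] An]] := omega_ex (omega_and (Qw k.+1) Akw).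
exact: (nA k).
Qed.

Definition internal : set (set (nat -> T)) :=
  [set S | exists2 A : nat -> set T, (forall n, measurable (A n)) & S = star A].

End hyper.

Definition hyper_display : measure_display -> measure_display. Proof. exact. Qed.

Definition hyper (T : Type) : Type := nat -> T.

Section hyper_algebra.
Context {d : measure_display} {T : measurableType d}.

HB.instance Definition _ := Pointed.copy (hyper T) (nat -> T).

Let internal0 : @internal d T set0.
Proof. by exists (fun=> set0) => //; rewrite star0. Qed.

Let internalU : setU_closed (@internal d T).
Proof.
move=> _ _ [A mA ->] [B mB ->]; exists (fun n => A n `|` B n); last by rewrite starU.
by move=> n; exact: measurableU.
Qed.

Let internalC : setC_closed (@internal d T).
Proof.
move=> _ [A mA ->]; exists (fun n => ~` A n); last by rewrite starC.
by move=> n; exact: measurableC.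
Qed.

HB.instance Definition _ := isAlgebraOfSets.Build (hyper_display d) (hyper T)
  internal0 internalU internalC.

End hyper_algebra.

Section loeb.
Context {R : realType} {d : measure_display} {T : measurableType d}.
Variable P : probability T R.

Definition internal_repr (S : set (hyper T)) : nat -> set T :=
  if pselect (internal S) is left h then s2val (cid2 h) else fun=> set0.

Lemma measurable_internal_repr S n : measurable (internal_repr S n).
Proof. by rewrite /internal_repr; case: pselect => // h; case: cid2. Qed.

Lemma star_internal_repr S : internal S -> star (internal_repr S) = S.
Proof. by rewrite /internal_repr; case: pselect => // h _; case: cid2. Qed.

(** Representatives are chosen globally so that the premeasure is defined on all
sets; [premeasure_star] shows that the value does not depend on the choice. *)
Definition premeasure (S : set (hyper T)) : \bar R :=
  (lim ((fun n => fine (P (internal_repr S n))) @ omega))%:E.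

Lemma fine_prob01 (A : set T) : measurable A -> 0 <= fine (P A) <= 1.
Proof.
move=> mA; rewrite fine_ge0//= -lee_fin fineK; last exact: fin_num_measure.
exact: probability_le1.
Qed.

Lemma cvg_fine_prob (A : nat -> set T) : (forall n, measurable (A n)) ->
  cvg ((fun n => fine (P (A n))) @ omega).
Proof.
move=> mA; apply: (@ultra_bounded_cvg _ _ 1); apply: filterE => n.
by have /andP[? ?] := fine_prob01 (mA n); rewrite ger0_norm.
Qed.

Lemma premeasure_star (A : nat -> set T) : (forall n, measurable (A n)) ->
  premeasure (star A) = (lim ((fun n => fine (P (A n))) @ omega))%:E.
Proof.
move=> mA; congr EFin.
have iA : internal (star A) by exists A.
apply: cvg_lim => //.
apply: cvg_trans (cvg_fine_prob mA).
apply: near_eq_cvg.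
by apply: omega_imp (star_inj (star_internal_repr iA)) => n ->.
Qed.

Lemma premeasure0 : premeasure set0 = 0%E.
Proof.
rewrite -star0 premeasure_star; last by move=> n; exact: measurable0.
by congr EFin; apply: cvg_lim => //; rewrite measure0; exact: cvg_cst.
Qed.

Lemma premeasure_ge0 S : (0 <= premeasure S)%E.
Proof.
rewrite lee_fin; apply: limr_ge.
  by apply: cvg_fine_prob; exact: measurable_internal_repr.
by apply: filterE => n; rewrite fine_ge0.
Qed.

Lemma premeasureU S S' : internal S -> internal S' -> S `&` S' = set0 ->
  premeasure (S `|` S') = (premeasure S + premeasure S')%E.
Proof.
move=> [A mA ->] [B mB ->]; rewrite -starI -starU => AB0.
have mAB n : measurable (A n `|` B n) by exact: measurableU.
rewrite !premeasure_star// -EFinD; congr EFin.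
rewrite -limD; [|exact: cvg_fine_prob..].
apply: cvg_lim => //.
have cAB : cvg ((fun n => fine (P (A n)) + fine (P (B n))) @ omega).
  by apply: is_cvgD; exact: cvg_fine_prob.
apply: cvg_trans cAB; apply: near_eq_cvg.
rewrite -star0 in AB0; apply: omega_imp (star_inj AB0) => n ABn.
by rewrite measureU// fineD//; exact: fin_num_measure.
Qed.

(** By saturation, a disjoint sequence of internal sets with internal union has
only finitely many nonempty terms, so finite additivity is enough. *)
Lemma premeasure_semi_sigma_additive : semi_sigma_additive premeasure.
Proof.
move=> F mF tF [B mB FB].
have [A hA] : exists A : nat -> nat -> set T,
    forall k, (forall n, measurable (A k n)) /\ F k = star (A k).
  suff /choice[A hA] k : exists A, (forall n, measurable (A n)) /\ F k = star A by exists A.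
  by have [A mA FA] := mF k; exists A.
have [N BN] : exists N, star B `<=` \bigcup_(k < N) F k.
  have [|N BN] := @star_saturation _ _ A B.
    by rewrite -FB => w [k _]; rewrite (hA k).2 => ?; exists k.
  by exists N => w /BN[k kN ?]; exists k => //; rewrite (hA k).2.
have sumE n : premeasure (\big[setU/set0]_(k < n) F k) =
    (\sum_(k < n) premeasure (F k))%E.
  elim: n => [|n IH]; first by rewrite !big_ord0 premeasure0.
  have mU : measurable (\big[setU/set0]_(k < n) F k) by exact: bigsetU_measurable.
  rewrite !big_ord_recr /= (premeasureU mU (mF n)) ?IH//.
  by apply: (@trivIset_bigsetUI _ predT) => //; exact: sub_trivIset tF.
apply: cvg_near_cst.
near=> n; rewrite big_mkord -sumE; congr premeasure.
apply/seteqP; split; first exact: bigsetU_bigcup.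
rewrite FB => w /BN[k /= kN Fk]; rewrite -bigcup_mkord; exists k => //=.
apply: (leq_trans kN); near: n; exact: nbhs_infty_ge.
Unshelve. all: by end_near. Qed.

HB.instance Definition _ := isMeasure.Build _ _ _ premeasure
  premeasure0 premeasure_ge0 premeasure_semi_sigma_additive.

Definition loeb_space := g_sigma_algebraType (@measurable _ (hyper T)).

Definition loeb : set loeb_space -> \bar R := measure_extension premeasure.

HB.instance Definition _ := Measure.on loeb.

Lemma loeb_star (A : nat -> set T) : (forall n, measurable (A n)) ->
  loeb (star A) = (lim ((fun n => fine (P (A n))) @ omega))%:E.
Proof.
move=> mA; rewrite /loeb /measure_extension measurable_mu_extE; last by exists A.
exact: premeasure_star.
Qed.

Lemma loebT : loeb setT = 1%E.
Proof.
rewrite -starT loeb_star//; congr EFin; apply: cvg_lim => //.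
by rewrite probability_setT; exact: cvg_cst.
Qed.

HB.instance Definition _ := Measure_isProbability.Build _ _ _ loeb loebT.

Lemma measurable_star (A : nat -> set T) : (forall n, measurable (A n)) ->
  measurable (star A : set loeb_space).
Proof. by move=> mA; apply: sub_sigma_algebra; exists A. Qed.

(** The probability of an internal set is the ultralimit of the probabilities of
its components. *)
Lemma loeb_near (A : nat -> set T) (e : R) : (forall n, measurable (A n)) -> 0 < e ->
  \forall n \near omega, (P (A n) <= loeb (star A) + e%:E)%E /\
    (loeb (star A) <= P (A n) + e%:E)%E.
Proof.
move=> mA e0; rewrite loeb_star//; set l := lim _.
have /cvgrPdist_le /(_ e e0) : (fun n => fine (P (A n))) @ omega --> l.
  exact: cvg_fine_prob.
apply: omega_imp => n; rewrite ler_norml => /andP[h1 h2].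
rewrite -[P (A n)]fineK; last exact: fin_num_measure.
by rewrite -!EFinD !lee_fin; split; lra.
Qed.

End loeb.
Arguments loeb_space {d} T.

(** * Ultralimits of random variables *)

Section tails.
Context {R : realType} d (T : measurableType d) (P : probability T R).

Lemma tail_small (V : T -> R) (e : R) : measurable_fun setT V -> 0 < e ->
  exists M : nat, (P [set w | M%:R < `|V w|]%R <= e%:E)%E.
Proof.
move=> mV e0; pose F (n : nat) := [set w | n%:R < `|V w|].
have mF n : measurable (F n) by exact: measurable_gt_norm.
have F0 : \bigcap_n F n = set0.
  apply/seteqP; split => // w Fw; have [k hk] := exists_nat_gt `|V w|.
  by have := Fw k I; rewrite /F /= ltNge (ltW hk).
have := @nonincreasing_cvg_mu _ _ _ P F; rewrite F0 measure0 => cF.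
have {}cF : P \o F @ \oo --> (0 : \bar R)%E.
  apply: cF => //; first by rewrite (le_lt_trans (probability_le1 P (mF _)))// ltry.
  move=> p q pq; apply/subsetPset => w; rewrite /F /=; apply: le_lt_trans.
  by rewrite ler_nat.
have /fine_cvgP[_ /cvgrPdist_le /(_ e e0)] := cF.
move=> [M _ /(_ M (leqnn M))] /=; rewrite sub0r normrN => h; exists M.
rewrite -[leLHS]fineK ?lee_fin ?(le_trans (ler_norm _) h)//.
by apply: fin_num_measure; exact: mF.
Qed.

(** A fixed random variable is tight, so multiplying it by constants that tend to 0
makes it small in probability. *)
Lemma infinitesimal_scaled (V : T -> R) (c : nat -> R) (f : nat -> T -> R) :
  measurable_fun setT V -> c @ \oo --> 0 ->
  (forall k e, 0 < e -> (P [set w | e < `|f k w|]%R <= P [set w | e < `|c k * V w|]%R)%E) ->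
  infinitesimal P f.
Proof.
move=> mV c0 fV e e0; have [M hM] := tail_small mV e0.
have /cvgrPdist_le /(_ (e / M.+1%:R)) : c @ \oo --> 0 by [].
rewrite divr_gt0// => /(_ isT); apply: filterS => k; rewrite sub0r normrN => ck.
apply: (le_trans (fV k e e0)); apply: le_trans hM; apply: le_prob.
- by apply: measurable_gt_norm; apply: measurable_funM.
- exact: measurable_gt_norm.
- move=> w /=; rewrite normrM => h.
  have {}h : e < e / M.+1%:R * `|V w|.
    by apply: (lt_le_trans h); rewrite ler_wpM2r.
  move: h; rewrite -mulrA -ltr_pdivrMl// mulVf ?gt_eqF// mulrC ltr_pdivlMr// mul1r.
  by apply: lt_trans; rewrite ltr_nat.
Qed.

Lemma ae_imp (A B : T -> Prop) : (forall w, A w -> B w) ->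
  {ae P, forall w, A w} -> {ae P, forall w, B w}.
Proof. exact: (@filterS _ (almost_everywhere P) (ae_filter_ringOfSetsType P)). Qed.

Lemma ae_and (A B : T -> Prop) : {ae P, forall w, A w} -> {ae P, forall w, B w} ->
  {ae P, forall w, A w /\ B w}.
Proof. exact: (@filterI _ (almost_everywhere P) (ae_filter_ringOfSetsType P)). Qed.

Lemma le_prob_ae (A B : set T) : measurable A -> measurable B ->
  {ae P, forall w, A w -> B w} -> (P A <= P B)%E.
Proof.
move=> mA mB [N [mN N0 sN]].
apply: (@le_trans _ _ (P (B `|` N))).
  apply: le_prob => //; first exact: measurableU.
  move=> w Aw; have [Bw|nBw] := pselect (B w); [by left|right].
  by apply: sN => /= /(_ Aw).
by apply: (le_trans (measureU2 P mB mN)); rewrite [X in (_ + X)%E](N0 : P N = 0%E) adde0.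
Qed.

End tails.

Section standard_part.
Context {R : realType} {d : measure_display} {T : measurableType d}.
Variable P : probability T R.
Local Notation Q := (loeb P).
Implicit Type f : nat -> T -> R.

(** The standard part of the hyperreal number represented by [f n (w n)]. *)
Definition st f (w : loeb_space T) : R := lim ((fun n => f n (w n)) @ omega).

Definition cvg_at f (w : loeb_space T) : Prop := cvg ((fun n => f n (w n)) @ omega).

(** The ultralimit exists exactly where the sequence is bounded along the
ultrafilter, a countable union of internal sets. *)
Lemma measurable_cvg_at f : (forall n, measurable_fun setT (f n)) ->
  measurable [set w | cvg_at f w].
Proof.
move=> mf.
have -> : [set w | cvg_at f w] =
    \bigcup_(M : nat) (star (fun n => ~` [set x | M%:R < `|f n x|])).
  apply/seteqP; split => w /=; last first.
    move=> [M _ h]; apply: ultra_bounded_cvg; apply: omega_imp h => n /= /negP.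
    by rewrite -leNgt; exact.
  move=> cw; set l := lim ((fun n => f n (w n)) @ omega).
  have [M hM] := exists_nat_gt (`|l| + 1); exists M => //.
  have /cvgrPdist_le /(_ 1 ltr01) : (fun n => f n (w n)) @ omega --> l by [].
  apply: omega_imp => n h /= Mf.
  have := ler_distD l 0 (f n (w n)); rewrite !sub0r !normrN => h'; lra.
apply: bigcup_measurable => M _; apply: measurable_star => n.
by apply: measurableC; exact: measurable_gt_norm.
Qed.

Lemma measurable_st f : (forall n, measurable_fun setT (f n)) ->
  measurable_fun setT (st f).
Proof.
move=> mf; apply: (measurability _ (RGenInftyO.measurableE R)) => //.
move=> _ [_ [a ->] <-]; rewrite setTI.
pose C : set (loeb_space T) := [set w | cvg_at f w].
pose S : set (loeb_space T) := \bigcup_k star (fun n => [set x | f n x < a - k.+1%:R^-1]).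
have mC : measurable C by exact: measurable_cvg_at.
have mS : measurable S.
  apply: bigcup_measurable => k _; apply: measurable_star => n.
  exact: measurable_lt.
(* Off the convergence set, [st f] takes the default value [point]. *)
have -> : st f @^-1` `]-oo, a[%classic =
    (C `&` S) `|` (~` C `&` (if (point : R) < a then setT else set0)).
  apply/seteqP; split => w /=; rewrite in_itv /=.
  - move=> lta; have [Cw|nCw] := pselect (C w); [left|right]; split => //.
      have e0 : 0 < (a - st f w) / 2 by rewrite divr_gt0// subr_gt0.
      have [k hk] := exists_nat_gt (((a - st f w) / 2)^-1); exists k => //.
      have hk' : k.+1%:R^-1 < (a - st f w) / 2.
        rewrite -[ltRHS]invrK ltf_pV2 ?posrE ?invr_gt0//.
        by apply: (lt_trans hk); rewrite ltr_nat.
      have /cvgrPdist_lt /(_ _ e0) : (fun n => f n (w n)) @ omega --> st f w by exact: Cw.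
      apply: omega_imp => n /=; rewrite ltr_norml => /andP[].
      by move: (k.+1%:R^-1) hk' => q hk'; lra.
    by move: lta; rewrite /st dvgP// => ->.
  - move=> [[Cw [k _ h]]|[nCw]].
      apply: (@le_lt_trans _ _ (a - k.+1%:R^-1)); last by rewrite gtrBl invr_gt0.
      by apply: limr_le => //; apply: omega_imp h => n /= /ltW.
    by rewrite /st dvgP//; case: ifP.
apply: measurableU; apply: measurableI => //; first exact: measurableC.
by case: ifP.
Qed.

Lemma small_null (A : set (loeb_space T)) : measurable A ->
  (forall e : R, 0 < e -> (Q A <= e%:E)%E) -> Q.-negligible A.
Proof.
move=> mA h; apply/negligibleP => //; apply/eqP; rewrite eq_le measure_ge0 andbT.
by apply/lee_addgt0Pr => e e0; rewrite add0e h.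
Qed.

Lemma loeb_star_le (A : nat -> set T) (x : R) : (forall n, measurable (A n)) ->
  (\forall n \near omega, (P (A n) <= x%:E)%E) -> (Q (star A) <= x%:E)%E.
Proof.
move=> mA h; apply/lee_addgt0Pr => e e0.
have [n [h1 [_ h2]]] := omega_ex (omega_and h (loeb_near P mA e0)).
by apply: (le_trans h2); exact: leeD2r.
Qed.

(** Tightness, here domination in law by one random variable, makes the ultralimit
finite almost surely. *)
Lemma ae_cvg_at f (V : T -> R) : (forall n, measurable_fun setT (f n)) ->
  measurable_fun setT V ->
  (forall n e, 0 < e -> (P [set w | e < `|f n w|]%R <= P [set w | e < `|V w|]%R)%E) ->
  {ae Q, forall w, cvg_at f w}.
Proof.
move=> mf mV fV; apply: small_null.
  by apply: measurableC; exact: measurable_cvg_at.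
move=> e e0; have [M hM] := tail_small P mV e0.
have mA n : measurable [set x | M.+1%:R < `|f n x|] by exact: measurable_gt_norm.
apply: (@le_trans _ _ (Q (star (fun n => [set x | M.+1%:R < `|f n x|])))).
  apply: le_prob.
  - by apply: measurableC; exact: measurable_cvg_at.
  - exact: measurable_star.
  - move=> w /= nC; apply: contrapT => /omega_not h; apply: nC.
    apply: (@ultra_bounded_cvg _ _ M.+1%:R); apply: omega_imp h => n /= /negP.
    by rewrite -leNgt.
apply: loeb_star_le => //; apply: filterE => n.
apply: (le_trans (fV n _ _)) => //; apply: le_trans hM; apply: le_prob.
- exact: measurable_gt_norm.
- exact: measurable_gt_norm.
- by move=> w /=; apply: lt_trans; rewrite ltr_nat.
Qed.

Lemma ae_infinitesimal f : (forall n, measurable_fun setT (f n)) ->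
  infinitesimal P f -> {ae Q, forall w, (fun n => f n (w n)) @ omega --> 0}.
Proof.
move=> mf f0.
have mA e n : measurable [set x | e < `|f n x|] by exact: measurable_gt_norm.
have ae e : 0 < e -> Q.-negligible (star (fun n => [set x | e < `|f n x|])).
  move=> e0; apply: small_null; first exact: measurable_star.
  move=> x x0; have m0 : 0 < Num.min e x by rewrite lt_min e0.
  apply: (@le_trans _ _ (Num.min e x)%:E); last by rewrite lee_fin ge_min lexx orbT.
  apply: (@le_trans _ _ (Q (star (fun n => [set y | Num.min e x < `|f n y|])))).
    apply: le_prob; try exact: measurable_star.
    by move=> w; apply: omega_imp => n /=; apply: le_lt_trans; rewrite ge_min lexx.
  by apply: loeb_star_le => //; apply: free_ultrafilter_eventually; exact: f0.
have aen k : {ae Q, forall w, ~ star (fun n => [set x | k.+1%:R^-1 < `|f n x|]) w}.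
  rewrite /almost_everywhere /=.
  apply: negligibleS (ae k.+1%:R^-1 _); last by rewrite invr_gt0.
  by move=> w /= /contrapT.
apply: ae_imp (ae_foralln aen) => w nw.
apply/cvgrPdist_le => e e0; have [k hk] := exists_nat_gt e^-1.
have /omega_not := nw k; apply: omega_imp => n /negP; rewrite -leNgt sub0r normrN.
move=> /le_trans; apply; rewrite -[leRHS]invrK lef_pV2 ?posrE ?invr_gt0//.
by rewrite (ltW (lt_trans hk _))// ltr_nat.
Qed.

(** Almost sure ultralimits are limits in law.  If the limit lies strictly below [a]
then so do most terms, and if most terms lie below [a] then the limit is at
most [a]; the probability of the internal event in between is approximated by
[loeb_near]. *)
Lemma loeb_cvg_law (I : Type) (A : nat -> I -> T -> R) (Y : I -> loeb_space T -> R) :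
  (forall n i, measurable_fun setT (A n i)) -> (forall i, measurable_fun setT (Y i)) ->
  (forall i, {ae Q, forall w, (fun n => A n i (w n)) @ omega --> Y i w}) ->
  cvg_law omega P Q A Y.
Proof.
move=> mA mY AY n t a e e0.
have ae : {ae Q, forall w, forall i : 'I_n,
    (fun n => A n (tnth t i) (w n)) @ omega --> Y (tnth t i) w}.
  apply: (@filter_forall _ 'I_n
    (fun i w => (fun n => A n (tnth t i) (w n)) @ omega --> Y (tnth t i) w)
    (almost_everywhere Q) (ae_filter_ringOfSetsType Q)).
  by move=> i; exact: AY.
have mB b k : measurable (below (A k) t b) by exact: measurable_below.
have le1 : (Q (below Y t a) <= Q (star (fun k => below (A k) t a)))%E.
  apply: le_prob_ae; [exact: measurable_below|exact: measurable_star|].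
  apply: ae_imp ae => w cw Yw.
  apply: (@filter_forall _ 'I_n (fun i k => A k (tnth t i) (w k) < a i) omega) => i.
  have e1 : 0 < a i - Y (tnth t i) w by rewrite subr_gt0.
  have /cvgrPdist_lt /(_ _ e1) := cw i.
  by apply: omega_imp => k; rewrite ltr_norml => /andP[]; lra.
have le2 : (Q (star (fun k => below (A k) t a)) <= Q (below Y t (fun i => a i + e)%R))%E.
  apply: le_prob_ae; [exact: measurable_star|exact: measurable_below|].
  apply: ae_imp ae => w cw Aw i.
  apply: (@le_lt_trans _ _ (a i)); last by rewrite ltrDl.
  rewrite -(cvg_lim (@Rhausdorff R) (cw i)).
  apply: limr_le; first by apply/cvg_ex; eexists; exact: cw.
  by apply: omega_imp Aw => k /(_ i)/ltW.
apply: omega_imp (loeb_near P (mB a) e0) => k [h1 h2]; split.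
  by apply: (le_trans h1); exact: leeD2r.
apply: (le_trans le1); apply: (le_trans h2); apply: leeD2r; apply: le_prob => //.
by apply: sub_below => i; rewrite lerDl ltW.
Qed.

End standard_part.

(** * Skeletons and increments of discrete-time processes *)

Section eq_fdd_tools.
Context {R : realType}.

Lemma eq_fdd_by d d' (T : measurableType d) (T' : measurableType d')
    (P : probability T R) (P' : probability T' R)
    (I : eqType) (J : Type) (L : J -> seq (R * I)) (X : I -> T -> R) (Y : I -> T' -> R)
    (X' : J -> T -> R) (Y' : J -> T' -> R) :
  eq_fdd P P' X Y ->
  (forall j w, X' j w = lincomb X (L j) w) ->
  (forall j w, Y' j w = lincomb Y (L j) w) -> eq_fdd P P' X' Y'.
Proof.
move=> XY hX hY.
have -> : X' = fun j => lincomb X (L j) by apply/funext => j; apply/funext.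
have -> : Y' = fun j => lincomb Y (L j) by apply/funext => j; apply/funext.
exact: eq_fdd_lincomb.
Qed.

Lemma eq_fdd_tail d d' (T : measurableType d) (T' : measurableType d')
    (P : probability T R) (P' : probability T' R) (I : Type) (X : I -> T -> R)
    (Y : I -> T' -> R) i (c e : R) : eq_fdd P P' X Y ->
  P [set w | e < `|c * X i w|] = P' [set w | e < `|c * Y i w|].
Proof.
move=> XY; apply: (eq_fdd1 i (B := [set x | e < `|c * x|]) XY).
by apply: measurable_gt_norm; apply: measurable_funM.
Qed.

Lemma le_tail d (T : measurableType d) (P : probability T R) (V : T -> R) (a b e : R) :
  measurable_fun setT V -> `|a| <= `|b| ->
  (P [set w | e < `|a * V w|]%R <= P [set w | e < `|b * V w|]%R)%E.
Proof.
move=> mV ab; apply: le_prob.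
- by apply: measurable_gt_norm; apply: measurable_funM.
- by apply: measurable_gt_norm; apply: measurable_funM.
- by move=> w /= /lt_le_trans; apply; rewrite !normrM ler_wpM2r.
Qed.

End eq_fdd_tools.

Section forward.
Context {R : realType} d (T : measurableType d) (P : probability T R).
Variable X : {nonneg R} -> {RV P >-> R}.

Lemma skeleton_scaling (H : R) (n : nat) :
  (forall a : {posnum R}, eq_fdd P P (fun (t : {nonneg R}) w => X (a%:num * t%:num)%:nng w)
                (fun t w => a%:num `^ H * X t w)) ->
  (0 < n)%N ->
  eq_fdd P P (fun m w => skeleton X (n * m)%N w) (fun m w => n%:R `^ H * skeleton X m w).
Proof.
move=> sX n0; have n0' : 0 < n%:R :> R by rewrite ltr0n.
apply: (eq_fdd_by (L := fun m => [:: (1, m%:R%:nng)]) (sX (PosNum n0'))) => m w;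
  rewrite /lincomb big_seq1 mul1r //.
by congr (X _ w); apply/val_inj; rewrite /= natrM.
Qed.

Lemma ss_si_skeleton : ss_si X -> dt_ss_si (skeleton X).
Proof.
move=> [[H H0 sX] iX]; exists (fun n => n%:R `^ H); split.
- by move=> n n0; rewrite powR_gt0 ?ltr0n.
- by move=> n n0; exact: skeleton_scaling.
- move=> k k0; apply: eq_fdd_sym.
  apply: (eq_fdd_by (L := fun m => [:: (1, (m + 1)%:R%:nng); (-1, m%:R%:nng)])
    (iX (k%:R)%:nng)) => m w;
    rewrite /lincomb !big_cons big_nil /= mul1r mulN1r addr0 opprB addrA subrK //.
  - congr (X _ w - X _ w); apply/val_inj => /=; last by rewrite natrD.
    by rewrite addnAC natrD.
  - by congr (X _ w - X _ w); exact/val_inj.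
Qed.

End forward.

Section discrete.
Context {R : realType} d (T : measurableType d) (P : probability T R).
Variables (X : nat -> {RV P >-> R}) (H : R).
Hypotheses (H0 : 0 < H) (dtX : dt_ss_si_with (fun n => n%:R `^ H) X).

(** The hypothesis concerns one-step increments; longer ones are telescoping sums
of those. *)
Lemma dt_increments k :
  eq_fdd P P (fun m w => X (m + k)%N w - X k w) (fun m w => X m w - X 0%N w).
Proof.
case: k => [|k]; first by under eq_fun do rewrite addn0.
have [_ _ /(_ k.+1 isT) h] := dtX; apply: eq_fdd_sym.
apply: (eq_fdd_by (L := fun m => [seq (1, i) | i <- index_iota 0 m]) h) => m w.
  rewrite /lincomb big_map -(telescope_sumr (fun i => X i w))//.
  by apply: eq_bigr => i _; rewrite mul1r addn1.
rewrite /lincomb big_map.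
have /= := telescope_sumr (fun i => X (i + k.+1)%N w) (leq0n m); rewrite add0n => <-.
by apply: eq_bigr => i _; rewrite mul1r addn1.
Qed.

Definition unit_increment (w : T) : R := X 1%N w - X 0%N w.
Local Notation V := unit_increment.

Lemma measurable_unit_increment : measurable_fun setT V.
Proof. exact: measurable_funB. Qed.

(** For [m > 0] the scaling relation is applied jointly at the times [m * 1] and
[m * 0].  For [m = 0] both sides vanish because [H != 0]. *)
Lemma increment_law m k :
  eq_fdd P P (fun (_ : unit) w => X (m + k)%N w - X k w)
    (fun _ w => m%:R `^ H * V w).
Proof.
have h1 : eq_fdd P P (fun (_ : unit) w => X (m + k)%N w - X k w)
    (fun _ w => X m w - X 0%N w).
  by apply: (eq_fdd_by (L := fun=> [:: (1, m)]) (dt_increments k)) => j w;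
    rewrite /lincomb big_seq1 mul1r.
apply: eq_fdd_trans h1 _; case: m => [|m].
  have <- : (fun (_ : unit) w => X 0%N w - X 0%N w) = (fun _ w => 0%:R `^ H * V w).
    by do 2!apply/funext => ?; rewrite subrr powR0 ?gt_eqF// mul0r.
  by move=> n t B mB.
have [_ /(_ m.+1 isT) h _] := dtX.
apply: (eq_fdd_by (L := fun=> [:: (1, 1%N); (-1, 0%N)]) h) => j w;
  rewrite /lincomb !big_cons big_nil addr0 mul1r mulN1r ?muln1 ?muln0//.
by rewrite /V mulrBr.
Qed.

Lemma increment_tail i j (c e : R) :
  P [set w | e < `|c * (X i w - X j w)|] =
  P [set w | e < `|c * `|i%:R - j%:R| `^ H * V w|].
Proof.
wlog ij : i j / (j <= i)%N => [h|].
  have [/h//|ji] := leqP j i; rewrite distrC -(h j i (ltnW ji)).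
  congr (P _); apply/seteqP; split => w /=; by rewrite !normrM distrC.
rewrite -natrB// normr_nat.
have := eq_fdd_tail tt c e (increment_law (i - j) j).
by under [X in _ = _ X -> _]eq_set do rewrite mulrA; rewrite subnK.
Qed.

Lemma increment_tail_le i j (c D e : R) : `|i%:R - j%:R| <= D ->
  (P [set w | e < `|c * (X i w - X j w)|]%R <= P [set w | e < `|c * D `^ H * V w|]%R)%E.
Proof.
move=> ijD; rewrite increment_tail; apply: le_tail; first exact: measurable_unit_increment.
rewrite !normrM ler_wpM2l// !(ger0_norm (powR_ge0 _ _)).
have D0 : 0 <= D by exact: le_trans (normr_ge0 _) ijD.
by rewrite ge0_ler_powR ?nnegrE ?(ltW H0).
Qed.

Definition scaling (k : nat) : R := k.+1%:R `^ H.
(** N^(-H) for the grid with N = (k + 1)^2 points per unit of time. *)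
Definition grid_factor (k : nat) : R := (scaling k ^+ 2)^-1.

Lemma scaling_gt0 k : 0 < scaling k. Proof. by rewrite powR_gt0. Qed.

Lemma powR_square k : (k.+1%:R ^+ 2) `^ H = scaling k ^+ 2.
Proof. by rewrite !expr2 powRM. Qed.

Lemma cvg_div_scaling (x : R) : (fun k => x / scaling k) @ \oo --> 0.
Proof.
apply/cvgrPdist_le => e e0; pose y := (`|x| / e) `^ H^-1.
apply: filterS (nbhs_infty_ger y) => k yk.
rewrite sub0r normrN normrM normfV (gtr0_norm (scaling_gt0 k)) ler_pdivrMr ?scaling_gt0//.
rewrite mulrC -ler_pdivrMr//.
have -> : `|x| / e = y `^ H.
  by rewrite /y -powRrM mulVf ?gt_eqF// powRr1// divr_ge0// ltW.
rewrite ge0_ler_powR ?nnegrE ?powR_ge0 ?(ltW H0)//.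
by rewrite (le_trans yk)// ler_nat.
Qed.

Lemma cvg_grid_factor : grid_factor @ \oo --> 0.
Proof.
have -> : grid_factor = fun k => (1 / scaling k) * (1 / scaling k).
  by apply/funext => k; rewrite /grid_factor expr2 invfM !mul1r.
by rewrite -[X in _ --> X](mulr0 0); apply: cvgM; exact: cvg_div_scaling.
Qed.

(** By [increment_tail_le] the increment over at most C (k + 1) steps is dominated
in law by (C (k + 1))^H V; divided by (k + 1)^(2 H) this is C^H V / (k + 1)^H,
which tends to 0. *)
Lemma infinitesimal_increment (i j : nat -> nat) (C : R) :
  (forall k, `|(i k)%:R - (j k)%:R| <= C * k.+1%:R) ->
  infinitesimal P (fun k w => grid_factor k * (X (i k) w - X (j k) w)).
Proof.
move=> ijC.
have C0 : 0 <= C.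
  by have := le_trans (normr_ge0 _) (ijC 0%N); rewrite mulr1.
apply: (infinitesimal_scaled measurable_unit_increment (cvg_div_scaling (C `^ H))) => k e e0.
apply: (le_trans (increment_tail_le _ _ (ijC k))).
rewrite powRM// -/(scaling k).
suff -> : grid_factor k * (C `^ H * scaling k) = C `^ H / scaling k by [].
by rewrite /grid_factor; field; rewrite gt_eqF ?scaling_gt0.
Qed.

End discrete.

(** * Construction of the continuous-time process *)

Lemma cvg_ext (R : realType) (F : set_system nat) (f g : nat -> R) (l : R) :
  (forall k, g k = f k) -> f @ F --> l -> g @ F --> l.
Proof. by move=> /funext ->. Qed.

Section process.
Context {R : realType} d (T : measurableType d) (P : probability T R).
Variables (X : nat -> {RV P >-> R}) (H : R).
Hypotheses (H0 : 0 < H) (dtX : dt_ss_si_with (fun n => n%:R `^ H) X).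
Local Notation Q := (loeb P).
Local Notation V := (unit_increment X).

(** Named so that the nonnegativity of the sum is inferred once and for all. *)
Definition nng_add (s t : {nonneg R}) : {nonneg R} := (s%:num + t%:num)%:nng.

Definition nng_mul (a : {posnum R}) (t : {nonneg R}) : {nonneg R} :=
  (a%:num * t%:num)%:nng.

Definition grid (k : nat) (t : R) : nat := Num.truncn (k.+1%:R ^+ 2 * t).

Lemma grid_itv k (t : R) : 0 <= t ->
  (grid k t)%:R <= k.+1%:R ^+ 2 * t < (grid k t)%:R + 1.
Proof.
move=> t0; have := truncn_itv (mulr_ge0 (sqr_ge0 k.+1%:R) t0).
by rewrite /grid natr1.
Qed.

Lemma succ_ge1 (k : nat) : 1 <= k.+1%:R :> R.
Proof. by rewrite ler1n. Qed.

Lemma nng_ge0 (t : {nonneg R}) : 0 <= t%:num.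
Proof. by []. Qed.

Lemma grid_nat k m : grid k m%:R = (k.+1 ^ 2 * m)%N.
Proof. by rewrite /grid -natrX -natrM natrK. Qed.

Definition approx_X (k : nat) (t : R) (w : T) : R := grid_factor H k * X (grid k t) w.

Lemma measurable_approx_X k t : measurable_fun setT (approx_X k t).
Proof. exact: measurable_funM. Qed.

Lemma measurable_scaled_diff (c : R) i j :
  measurable_fun setT (fun w => c * (X i w - X j w)).
Proof. by apply: measurable_funM => //; exact: measurable_funB. Qed.

(** The increment from 0 is dominated in law by t^H V at every stage, and the
rescaled initial value tends to 0. *)
Lemma ae_cvg_approx_X t : 0 <= t -> {ae Q, forall w, cvg_at (fun k => approx_X k t) w}.
Proof.
move=> t0.
have h1 : {ae Q, forall w, cvg_at (fun k w => grid_factor H k * (X (grid k t) w - X 0%N w)) w}.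
  apply: (ae_cvg_at (V := fun w => t `^ H * V w)).
  - by move=> k; exact: measurable_scaled_diff.
  - by apply: measurable_funM => //; exact: measurable_unit_increment.
  - move=> k e e0.
    apply: (le_trans (increment_tail_le H0 dtX _ _ (D := k.+1%:R ^+ 2 * t) _)).
      by rewrite subr0 normr_nat; have /andP[] := grid_itv k t0.
    rewrite powRM// powR_square mulrA mulVf ?mul1r// gt_eqF// exprn_gt0//.
    exact: scaling_gt0.
have h2 : {ae Q, forall w, (fun k => grid_factor H k * X 0%N (w k)) @ omega --> 0}.
  apply: (ae_infinitesimal (f := fun k w => grid_factor H k * X 0%N w)).
    by move=> k; exact: measurable_funM.
  by apply: (infinitesimal_scaled (V := X 0%N) _ (cvg_grid_factor H0)) => // k e e0.
apply: ae_imp (ae_and h1 h2) => w [c1 c2].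
apply/cvg_ex; eexists; apply: cvg_ext (cvgD c1 c2) => k.
by rewrite /approx_X /= fctE mulrBr subrK.
Qed.

Definition process (t : {nonneg R}) : {RV Q >-> R} :=
  mfun_Sub (mem_set (measurable_st (fun k => measurable_approx_X k t%:num))).

Lemma ae_cvg_process (t : {nonneg R}) :
  {ae Q, forall w, (fun k => approx_X k t%:num (w k)) @ omega --> process t w}.
Proof. by apply: ae_imp (ae_cvg_approx_X (nng_ge0 t)) => w; exact. Qed.

(** The limit does not see index errors of order k on a grid of mesh
(k + 1)^(-2). *)
Lemma ae_cvg_scaled_index (t : {nonneg R}) (i : nat -> nat) (C : R) :
  (forall k, `|(i k)%:R - (grid k t%:num)%:R| <= C * k.+1%:R) ->
  {ae Q, forall w, (fun k => grid_factor H k * X (i k) (w k)) @ omega --> process t w}.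
Proof.
move=> hi.
have h := ae_infinitesimal (fun k => measurable_scaled_diff (grid_factor H k) (i k) (grid k t%:num))
  (infinitesimal_increment H0 dtX hi).
apply: ae_imp (ae_and h (ae_cvg_process t)) => w [c1 c2].
rewrite -[X in _ --> X]add0r; apply: cvg_ext (cvgD c1 c2) => k.
by rewrite /approx_X fctE mulrBr subrK.
Qed.

Lemma cvg_law_process :
  cvg_law omega P Q (fun k (t : {nonneg R}) => approx_X k t%:num) process.
Proof.
apply: loeb_cvg_law.
- by move=> k t; exact: measurable_approx_X.
- by move=> t; exact: measurable_funPT.
- exact: ae_cvg_process.
Qed.

(** At integer times the rescaled walk has exactly the law of [X]. *)
Lemma process_skeleton : eq_fdd Q P (skeleton process) X.
Proof.
have c1 : cvg_law omega P Q (fun k m => approx_X k m%:R) (skeleton process).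
  apply: loeb_cvg_law.
  - by move=> k m; exact: measurable_approx_X.
  - by move=> m; exact: measurable_funPT.
  - by move=> m; exact: (ae_cvg_process m%:R%:nng).
have c2 : cvg_law omega P P (fun k m => X m) X.
  apply: cvg_law_in_prob; first exact: free_ultrafilter_eventually.
  - by move=> k m; exact: measurable_funPT.
  - by move=> m; exact: measurable_funPT.
  - move=> m e e0; apply: nearW => k.
    rewrite (_ : [set w | _] = set0) ?measure0 ?lee_fin ?ltW//.
    by apply/seteqP; split => // w /=; rewrite subrr normr0 ltNge (ltW e0).
apply: (cvg_law_unique _ _ c1 c2); [by move=> m; exact: measurable_funPT..|].
apply: filterE => k; have [_ /(_ (k.+1 ^ 2)%N) h _] := dtX.
apply: (eq_fdd_by (L := fun m => [:: (grid_factor H k, m)]) (h _)) => [|m w|m w].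
- by rewrite expn_gt0.
- by rewrite /lincomb big_seq1 /approx_X grid_nat.
- rewrite /lincomb big_seq1 /= natrX powR_square mulrA mulVf ?mul1r//.
  by rewrite gt_eqF// exprn_gt0// scaling_gt0.
Qed.

Lemma process_stationary (h : {nonneg R}) :
  eq_fdd Q Q (fun (t : {nonneg R}) w => process (nng_add t h) w - process h w)
    (fun t w => process t w - process 0%:nng w).
Proof.
pose A k (t : {nonneg R}) w :=
  grid_factor H k * (X (grid k t%:num + grid k h%:num)%N w - X (grid k h%:num) w).
pose B k (t : {nonneg R}) w := grid_factor H k * (X (grid k t%:num) w - X 0%N w).
have g0 k : grid k 0 = 0%N by rewrite -[0]/(0%:R) grid_nat muln0.
have cA : cvg_law omega P Q A
    (fun t w => process (nng_add t h) w - process h w).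
  apply: loeb_cvg_law.
  - by move=> k t; exact: measurable_scaled_diff.
  - by move=> t; apply: measurable_funB; exact: measurable_funPT.
  - move=> t.
    pose th := nng_add t h.
    have h1 : {ae Q, forall w, (fun k =>
        grid_factor H k * X (grid k t%:num + grid k h%:num)%N (w k)) @ omega --> process th w}.
      apply: (ae_cvg_scaled_index (C := 2)) => k.
      have /andP[a1 a2] := grid_itv k (nng_ge0 t).
      have /andP[b1 b2] := grid_itv k (nng_ge0 h).
      have /andP[] := grid_itv k (nng_ge0 th).
      rewrite /= natrD mulrDr.
      move: (k.+1%:R) (succ_ge1 k) a1 a2 b1 b2 => K K1.
      move=> a1 a2 b1 b2 c1 c2.
      (* The three roundings differ by less than 2 <= 2 K. *)
      by rewrite ler_norml; apply/andP; split; lra.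
    apply: ae_imp (ae_and h1 (ae_cvg_process h)) => w [c1 c2].
    apply: cvg_ext (cvgB c1 c2) => k.
    by rewrite /A /approx_X fctE mulrBr.
have cB : cvg_law omega P Q B (fun t w => process t w - process 0%:nng w).
  apply: loeb_cvg_law.
  - by move=> k t; exact: measurable_scaled_diff.
  - by move=> t; apply: measurable_funB; exact: measurable_funPT.
  - move=> t; apply: ae_imp (ae_and (ae_cvg_process t) (ae_cvg_process 0%:nng)) => w [c1 c2].
    apply: cvg_ext (cvgB c1 c2) => k.
    by rewrite /B /approx_X !fctE mulrBr /= g0.
apply: (cvg_law_unique _ _ cA cB).
- by move=> t; apply: measurable_funB; exact: measurable_funPT.
- by move=> t; apply: measurable_funB; exact: measurable_funPT.
apply: filterE => k.
by apply: (eq_fdd_by (L := fun t : {nonneg R} => [:: (grid_factor H k, grid k t%:num)])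
  (dt_increments dtX (grid k h%:num))) => t w; rewrite /lincomb big_seq1.
Qed.

(** At stage k the walk is observed at [p k * q k t], where [p k] approximates
(k + 1) a and [q k t] approximates (k + 1) t.  This index is within O(k) of the
grid index of a t, so the observation tends to [process (a t)].  Discrete
scaling by the integer [p k] and, backwards, by k + 1 gives it the law of
(p_k / (k + 1))^H times the walk at index (k + 1) [q k t], which tends to
a^H times [process t]. *)
Lemma process_scaling (a : {posnum R}) :
  eq_fdd Q Q (fun (t : {nonneg R}) w => process (nng_mul a t) w)
    (fun t w => a%:num `^ H * process t w).
Proof.
have a0 : 0 < a%:num by [].
pose p k : nat := Num.truncn (k.+1%:R * a%:num).
pose q k (t : {nonneg R}) : nat := Num.truncn (k.+1%:R * t%:num).
have p_itv k : (p k)%:R <= k.+1%:R * a%:num < (p k)%:R + 1.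
  by have := truncn_itv (mulr_ge0 (ler0n R k.+1) (ltW a0)); rewrite natr1.
have q_itv k t : (q k t)%:R <= k.+1%:R * t%:num < (q k t)%:R + 1.
  by have := truncn_itv (mulr_ge0 (ler0n R k.+1) (nng_ge0 t)); rewrite natr1.
pose A k t w := grid_factor H k * X (p k * q k t)%N w.
pose B k t w := (p k)%:R `^ H / scaling H k * (grid_factor H k * X (k.+1 * q k t)%N w).
have cA : cvg_law omega P Q A (fun t w => process (nng_mul a t) w).
  apply: loeb_cvg_law.
  - by move=> k t; exact: measurable_funM.
  - by move=> t; exact: measurable_funPT.
  - move=> t; apply: (ae_cvg_scaled_index (C := a%:num + t%:num + 2)) => k.
    have /andP[a1 a2] := p_itv k; have /andP[b1 b2] := q_itv k t.
    have /andP[] := grid_itv k (nng_ge0 (nng_mul a t)).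
    rewrite /= natrM; move: (k.+1%:R) (succ_ge1 k) a1 a2 b1 b2 => K K1.
    move: (ler0n R (p k)) (ler0n R (q k t)).
    move: ((p k)%:R : R) ((q k t)%:R : R) ((grid k (a%:num * t%:num))%:R : R).
    move=> x y z x0 y0 a1 a2 b1 b2 c1 c2.
    (* Rounding both factors costs at most x + y + 1, hence O(K). *)
    have u1 : x * y <= K * a%:num * (K * t%:num) by apply: ler_pM.
    have u2 : K * a%:num * (K * t%:num) <= (x + 1) * (y + 1).
      by apply: ler_pM; rewrite ?mulr_ge0 ?(ltW a2) ?(ltW b2)//; lra.
    have -> : (a%:num + t%:num + 2) * K = K * a%:num + K * t%:num + 2 * K by ring.
    have e1 : K ^+ 2 * (a%:num * t%:num) = K * a%:num * (K * t%:num) by ring.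
    rewrite e1 in c1 c2.
    by rewrite ler_norml; apply/andP; split; lra.
have cB : cvg_law omega P Q B (fun t w => a%:num `^ H * process t w).
  apply: loeb_cvg_law.
  - by move=> k t; do 2!apply: measurable_funM => //.
  - by move=> t; apply: measurable_funM => //; exact: measurable_funPT.
  - move=> t.
    have h1 : {ae Q, forall w, (fun k => grid_factor H k * X (k.+1 * q k t)%N (w k)) @ omega -->
        process t w}.
      apply: (ae_cvg_scaled_index (C := 2)) => k.
      have /andP[a1 a2] := q_itv k t; have /andP[] := grid_itv k (nng_ge0 t).
      rewrite natrM; move: (k.+1%:R) (succ_ge1 k) a1 a2 => K K1.
      move: (ler0n R (q k t)); move: ((q k t)%:R : R) ((grid k t%:num)%:R : R).
      move=> x z x0 a1 a2 c1 c2.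
      have K0 : 0 <= K by lra.
      have u1 := ler_wpM2l K0 a1; have u2 := ler_wpM2l K0 (ltW a2).
      have e1 : K ^+ 2 * t%:num = K * (K * t%:num) by ring.
      rewrite e1 in c1 c2; rewrite mulrDr mulr1 in u2.
      by rewrite ler_norml; apply/andP; split; lra.
    apply: ae_imp h1 => w c1; apply: cvgM c1.
    suff : (fun k => (p k)%:R `^ H / scaling H k) @ \oo --> a%:num `^ H.
      by move=> h N /h; exact: free_ultrafilter_eventually.
    have pk : (fun k => (p k)%:R / k.+1%:R) @ \oo --> a%:num.
      apply/cvgrPdist_le => e e0; apply: filterS (nbhs_infty_ger e^-1) => k ek.
      have /andP[a1 a2] := p_itv k.
      have K0 : 0 < k.+1%:R :> R by [].
      have Ke : 1 <= e * k.+1%:R.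
        by rewrite mulrC -ler_pdivrMr// div1r (le_trans ek)// ler_nat.
      rewrite -(ler_pM2r K0) -[X in _ * X <= _](gtr0_norm K0) -normrM mulrBl divfK ?gt_eqF//.
      by rewrite mulrC ler_norml; apply/andP; split; lra.
    have -> : (fun k => (p k)%:R `^ H / scaling H k) = fun k => ((p k)%:R / k.+1%:R) `^ H.
      apply/funext => k; have r0 : scaling H k != 0 by rewrite gt_eqF// scaling_gt0.
      apply: (mulIf r0); rewrite divfK// /scaling -powRM ?divr_ge0//.
      by rewrite divfK// pnatr_eq0.
    have cH : {for a%:num, continuous (fun x : R => x `^ H)}.
      apply: differentiable_continuous; apply/derivable1_diffP/derivable_powR.
      by rewrite in_itv/= andbT.
    by move=> N /cH /pk.
apply: (cvg_law_unique _ _ cA cB).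
- by move=> t; exact: measurable_funPT.
- by move=> t; apply: measurable_funM => //; exact: measurable_funPT.
have pgt0 : \forall k \near omega, (0 < p k)%N.
  apply: free_ultrafilter_eventually.
  apply: filterS (nbhs_infty_ger (a%:num^-1)) => k ak.
  by rewrite /p truncn_gt0 -ler_pdivrMr// div1r (le_trans ak)// ler_nat.
apply: omega_imp pgt0 => k pk.
have [_ h _] := dtX.
have hp := h _ pk; have hk := h k.+1 isT.
apply: (@eq_fdd_trans _ _ _ _ _ _ _ P P P _ _
  (fun t w => grid_factor H k * ((p k)%:R `^ H * X (q k t) w))).
  by apply: (eq_fdd_by (L := fun t => [:: (grid_factor H k, q k t)]) hp) => t w;
    rewrite /lincomb big_seq1.
apply: eq_fdd_sym.
apply: (eq_fdd_by (L := fun t =>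
  [:: ((p k)%:R `^ H / scaling H k * grid_factor H k, q k t)]) hk) => t w;
  rewrite /lincomb big_seq1 /=.
- by rewrite /B mulrA.
- by rewrite -/(scaling H k); field; rewrite gt_eqF// scaling_gt0.
Qed.

End process.

(** * Uniqueness and the theorem *)

Section uniqueness.
Context {R : realType} d (T : measurableType d) (P : probability T R).
Variables (X : nat -> {RV P >-> R}) (H : R).
Hypotheses (H0 : 0 < H) (dtX : dt_ss_si_with (fun n => n%:R `^ H) X).
Context d' (T' : measurableType d') (P' : probability T' R).
Variable Z : {nonneg R} -> {RV P' >-> R}.
Hypothesis ZX : eq_fdd P' P (skeleton Z) X.
Variable H' : R.
Hypothesis H'0 : 0 <= H'.
Hypothesis sZ : forall a : {posnum R},
  eq_fdd P' P' (fun (t : {nonneg R}) w => Z (a%:num * t%:num)%:nng w)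
    (fun t w => a%:num `^ H' * Z t w).
Hypothesis iZ : forall h : {nonneg R},
  eq_fdd P' P' (fun (t : {nonneg R}) w => Z (t%:num + h%:num)%:nng w - Z h w)
    (fun t w => Z t w - Z 0%:nng w).

(** [X (n * m)] is, in law as a process in m, both n^H' X and n^H X; multiplying
both by n^(- H - H') gives n^(-H) X and n^(-H') X the same law. *)
Lemma skeleton_exponents n : (0 < n)%N ->
  eq_fdd P' P (fun m w => n%:R `^ (- H') * skeleton Z m w)
    (fun m w => n%:R `^ (- H) * X m w).
Proof.
move=> n0; have n0' : 0 < n%:R :> R by rewrite ltr0n.
have [_ /(_ n n0) sX _] := dtX.
have h1 := eq_fdd_sym (skeleton_scaling sZ n0).
have h2 : eq_fdd P' P (fun m w => skeleton Z (n * m)%N w) (fun m w => X (n * m)%N w).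
  by apply: (eq_fdd_by (L := fun m => [:: (1, (n * m)%N)]) ZX) => m w;
    rewrite /lincomb big_seq1 mul1r.
have h := eq_fdd_trans h1 (eq_fdd_trans h2 sX).
have h3 : eq_fdd P' P (fun m w => n%:R `^ (- H) * skeleton Z m w)
    (fun m w => n%:R `^ (- H') * X m w).
  apply: (eq_fdd_by (L := fun m => [:: (n%:R `^ (- H') * n%:R `^ (- H), m)]) h) => m w;
    by rewrite /lincomb big_seq1 /= !powRN; field; rewrite !gt_eqF ?powR_gt0.
have h4 : eq_fdd P P' (fun m w => n%:R `^ (- H) * X m w)
    (fun m w => n%:R `^ (- H) * skeleton Z m w).
  by apply: (eq_fdd_by (L := fun m => [:: (n%:R `^ (- H), m)]) (eq_fdd_sym ZX)) => m w;
    rewrite /lincomb big_seq1.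
have h5 : eq_fdd P P' (fun m w => n%:R `^ (- H') * X m w)
    (fun m w => n%:R `^ (- H') * skeleton Z m w).
  by apply: (eq_fdd_by (L := fun m => [:: (n%:R `^ (- H'), m)]) (eq_fdd_sym ZX)) => m w;
    rewrite /lincomb big_seq1.
exact: eq_fdd_sym (eq_fdd_trans h4 (eq_fdd_trans h3 h5)).
Qed.

Definition frac (m n : nat) : {nonneg R} := (m%:R / n%:R)%:nng.

Lemma frac_law n : (0 < n)%N ->
  eq_fdd P' P (fun m w => Z (frac m n) w) (fun m w => n%:R `^ (- H) * X m w).
Proof.
move=> n0; have n0' : 0 < n%:R^-1 :> R by rewrite invr_gt0 ltr0n.
apply: eq_fdd_trans (skeleton_exponents n0).
apply: (eq_fdd_by (L := fun m => [:: (1, m%:R%:nng)]) (sZ (PosNum n0'))) => m w;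
  rewrite /lincomb big_seq1 mul1r /=.
- by congr (Z _ w); apply/val_inj; rewrite /= mulrC.
- by congr (_ * _); rewrite -powR_inv1// -powRrM mulN1r.
Qed.

Local Notation V := (fun w => Z 1%:nng w - Z 0%:nng w).

Lemma measurable_unit_increment_Z : measurable_fun setT V.
Proof. exact: measurable_funB. Qed.

(** For s = 0 the increment vanishes.  Otherwise it has the law of s^H' V, which
is dominated by n^(-H') V since s <= 1 / n, and n^(-H') V has the law of
n^(-H) V by [skeleton_exponents].  So the bound tends to 0 as n grows even if
H' = 0. *)
Lemma small_increment_tail (u s : {nonneg R}) (n : nat) (e : R) : (0 < n)%N ->
  s%:num <= n%:R^-1 -> 0 < e ->
  (P' [set w | e < `|Z (nng_add s u) w - Z u w|]%R <=
   P' [set w | e < `|n%:R `^ (- H) * V w|]%R)%E.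
Proof.
move=> n0 sn e0; have n0' : 0 < n%:R :> R by rewrite ltr0n.
have -> : P' [set w | e < `|Z (nng_add s u) w - Z u w|] =
    P' [set w | e < `|Z s w - Z 0%:nng w|].
  have := eq_fdd_tail s 1 e (iZ u).
  by under eq_set do rewrite mul1r; under [X in _ = _ X]eq_set do rewrite mul1r.
have := le0r s%:num; rewrite nng_ge0 => /esym /orP[/eqP s0|s0].
  rewrite (_ : [set w | _] = set0) ?measure0//.
  apply/seteqP; split => // w /=.
  have -> : s = 0%:nng by exact/val_inj.
  by rewrite subrr normr0 ltNge (ltW e0).
have h1 : eq_fdd P' P' (fun (_ : unit) w => Z s w - Z 0%:nng w)
    (fun _ w => s%:num `^ H' * V w).
  apply: (eq_fdd_by (L := fun=> [:: (1, 1%:nng); (-1, 0%:nng)]) (sZ (PosNum s0))) => j w;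
    rewrite /lincomb !big_cons big_nil addr0 mul1r mulN1r //=.
    by congr (Z _ w - Z _ w); apply/val_inj; rewrite /= ?mulr1 ?mulr0.
  by rewrite mulrBr.
have h2 : eq_fdd P' P' (fun (_ : unit) w => n%:R `^ (- H') * V w)
    (fun _ w => n%:R `^ (- H) * V w).
  have h3 : eq_fdd P P' (fun m w => n%:R `^ (- H) * X m w)
      (fun m w => n%:R `^ (- H) * skeleton Z m w).
    by apply: (eq_fdd_by (L := fun m => [:: (n%:R `^ (- H), m)]) (eq_fdd_sym ZX)) => m w;
      rewrite /lincomb big_seq1.
  apply: (eq_fdd_by (L := fun=> [:: (1, 1%N); (-1, 0%N)])
    (eq_fdd_trans (skeleton_exponents n0) h3)) => j w;
    rewrite /lincomb !big_cons big_nil addr0 mul1r mulN1r mulrBr /skeleton;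
    by congr (_ * Z _ w - _ * Z _ w); apply/val_inj.
have t1 := eq_fdd_tail tt 1 e h1; have t2 := eq_fdd_tail tt 1 e h2.
have E (f : T' -> R) : [set w | e < `|1 * f w|] = [set w | e < `|f w|].
  by under eq_set do rewrite mul1r.
rewrite !E in t1 t2; rewrite t1 -t2; apply: le_tail; first exact: measurable_unit_increment_Z.
rewrite !(ger0_norm (powR_ge0 _ _)) powRN -powR_inv1 ?powR_ge0// -powRrM mulrC powRrM.
by rewrite powR_inv1 ?ler0n// ge0_ler_powR ?nnegrE ?invr_ge0 ?ler0n.
Qed.

Lemma cvg_law_frac :
  cvg_law omega P' P'
    (fun k (t : {nonneg R}) => Z (frac (grid k t%:num) (k.+1 ^ 2))) Z.
Proof.
apply: cvg_law_in_prob; first exact: free_ultrafilter_eventually.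
- by move=> k t; exact: measurable_funPT.
- by move=> t; exact: measurable_funPT.
- move=> t.
  apply: (infinitesimal_scaled measurable_unit_increment_Z (cvg_grid_factor H0)) => k e e0.
  set N := (k.+1 ^ 2)%N; set u := frac _ _.
  have N0 : (0 < N)%N by rewrite expn_gt0.
  have N0' : 0 < N%:R :> R by rewrite ltr0n.
  have /andP[g1 g2] := grid_itv k (nng_ge0 t).
  have NE : N%:R = k.+1%:R ^+ 2 :> R by rewrite /N natrX.
  rewrite -NE in g1 g2.
  have uE : u%:num = (grid k t%:num)%:R / N%:R by [].
  have s0 : 0 <= t%:num - u%:num by rewrite subr_ge0 uE ler_pdivrMr// mulrC.
  have -> : t = nng_add (NngNum s0) u by apply/val_inj; rewrite /= subrK.
  have -> : grid_factor H k = N%:R `^ (- H) by rewrite powRN NE powR_square.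
  have -> : [set w | e < `|Z u w - Z (nng_add (NngNum s0) u) w|] =
      [set w | e < `|Z (nng_add (NngNum s0) u) w - Z u w|].
    by apply/seteqP; split => w /=; rewrite distrC.
  apply: small_increment_tail => //=.
  by rewrite uE -[leRHS]div1r lerBlDr -mulrDl ler_pdivlMr// mulrC addrC ltW//.
Qed.

Lemma process_unique : eq_fdd P' (loeb P) Z (process X H).
Proof.
apply: (cvg_law_unique _ _ cvg_law_frac (cvg_law_process H0 dtX)).
- by move=> t; exact: measurable_funPT.
- by move=> t; exact: measurable_funPT.
apply: filterE => k; have k0 : (0 < k.+1 ^ 2)%N by rewrite expn_gt0.
apply: (eq_fdd_by (L := fun t : {nonneg R} => [:: (1, grid k t%:num)]) (frac_law k0)) => t w;
  rewrite /lincomb big_seq1 mul1r //.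
by rewrite /approx_X natrX powRN powR_square.
Qed.

End uniqueness.

Theorem theorem3p9 (R : realType) :
  (forall (d : measure_display) (T : measurableType d) (P : probability T R)
          (X : {nonneg R} -> {RV P >-> R}),
      ss_si X -> dt_ss_si (skeleton X))
  /\
  (forall (d : measure_display) (T : measurableType d) (P : probability T R)
          (X : nat -> {RV P >-> R}) (H : R),
      0 < H -> dt_ss_si_with (fun n => n%:R `^ H) X ->
      exists (d' : measure_display) (T' : measurableType d')
             (P' : probability T' R) (Y : {nonneg R} -> {RV P' >-> R}),
        [/\ ss_si Y,
            eq_fdd P' P (skeleton Y) X
          & forall (d'' : measure_display) (T'' : measurableType d'')
                   (P'' : probability T'' R)
                   (Z : {nonneg R} -> {RV P'' >-> R}),
              ss_si Z -> eq_fdd P'' P (skeleton Z) X -> eq_fdd P'' P' Z Y]).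
Proof.
split=> [d T P X|d T P X H H0 dtX]; first exact: ss_si_skeleton.
exists _, (loeb_space T), (loeb P), (process X H); split.
- split; first by exists H; [exact: ltW|exact: process_scaling].
  exact: process_stationary.
- exact: process_skeleton.
- by move=> d'' T'' P'' Z [[H' H'0 sZ] iZ] ZX; exact: (process_unique H0 dtX ZX H'0 sZ iZ).
Qed.
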